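(* Let $R$ be a commutative ring with identity and let $M$ be a comorphic $R$-module which satisfies the double annihilator conditions ($DAC$) and such that $I^M_0(M)\neq 0$. Then: (a) $R$ is a morphic ring; (b) $M$ is a co-Bézout module.
   Context: A proper submodule $N$ of an $R$-module $M$ is completely irreducible if whenever $N=\bigcap_{i\in I}N_i$ for a family $\{N_i\}_{i\in I}$ of submodules of $M$, then $N=N_i$ for some $i\in I$. For a submodule $N$ of $M$, $(N:_RM)=\{r\in R: rM\subseteq N\}$; $\mathrm{Ann}_R(X)$ denotes the annihilator in $R$ of $X$. An $R$-module $M$ is comorphic if for each completely irreducible submodule $L$ of $M$ there exists $a\in R$ such that $L=aM$ and $(L:_RM)=Ra+\mathrm{Ann}_R(M)$. $M$ satisfies the double annihilator conditions ($DAC$) if $I=\mathrm{Ann}_R((0:_MI))$ for each ideal $I$ of $R$, where $(0:_MI)=\{m\in M: Im=0\}$. $I^M_0(M)$ is the intersection of all completely irreducible submodules $L$ of $M$ such that $rM\subseteq L$ for some $0\neq r\in R$ (an empty intersection being $M$). $R$ is a morphic ring if $R/Ra\cong \mathrm{Ann}_R(Ra)$ as $R$-modules for every $a\in R$. A module is finitely cogenerated if every family of its submodules with zero intersection has a finite subfamily with zero intersection. $M$ is a co-Bézout module if every proper submodule $N$ of $M$ such that $M/N$ is finitely cogenerated is a completely irreducible submodule of $M$. *)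

(* Defs.v *)
From HB Require Import structures.
From mathcomp Require Import all_boot all_algebra.
From mathcomp Require Import boolp classical_sets cardinality.

Set Implicit Arguments.
Unset Strict Implicit.
Unset Printing Implicit Defensive.

Import GRing.Theory.

Local Open Scope quotient_scope.
Local Open Scope classical_set_scope.
Local Open Scope ring_scope.

(* Submodules are Prop-valued sets; [in_set] is the (classical) boolean
   membership predicate that the algebraic hierarchy works with. *)
Record submodule (R : pzRingType) (M : lmodType R) := Submodule {
  submodule_set :> set M;
  submodule_closed : submod_closed (in_set submodule_set)
}.

(* Ideals of a commutative ring R are the submodules of R^o. *)
Notation ideal R := (submodule R^o).

Definition submodule_pred (R : pzRingType) (M : lmodType R)
  (N : submodule M) : {pred M} := in_set N.

HB.instance Definition _ (R : pzRingType) (M : lmodType R) (N : submodule M) :=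
  GRing.isSubmodClosed.Build R M (submodule_pred N) (submodule_closed N).

Section SubmoduleAsModule.
Variables (R : pzRingType) (M : lmodType R) (N : submodule M).

Definition submod : Type := {x : M | submodule_pred N x}.

HB.instance Definition _ := SubChoice.on submod.
HB.instance Definition _ := [SubChoice_isSubLmodule of submod by <:].
End SubmoduleAsModule.

Section QuotientModule.
Variables (R : pzRingType) (M : lmodType R) (N : submodule M).

(* [Quotient.quot] is the library's quotient of an abelian group; the scalar
   multiplication is added to it below. *)
Definition quotmod : Type := Quotient.quot (submodule_pred N).

HB.instance Definition _ := ZmodQuotient.on quotmod.

Definition quotmod_scale (a : R) (x : quotmod) : quotmod :=
  \pi_quotmod (a *: repr x).

Lemma pi_quotmod_surj (x : quotmod) : exists y : M, x = \pi_quotmod y.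
Proof. by exists (repr x); rewrite reprK. Qed.

Lemma pi_quotmodE (x y : M) :
  (\pi_quotmod x == \pi_quotmod y) = (x - y \in submodule_pred N).
Proof. by rewrite Quotient.idealrBE. Qed.

Lemma pi_quotmodZ (a : R) (x : M) :
  quotmod_scale a (\pi_quotmod x) = \pi_quotmod (a *: x).
Proof.
apply/eqP; rewrite pi_quotmodE -scalerBr; apply: rpredZ.
by rewrite -pi_quotmodE reprK.
Qed.

Lemma pi_quotmodD (x y : M) :
  \pi_quotmod (x + y) = \pi_quotmod x + \pi_quotmod y.
Proof. exact: pi_addr. Qed.

Lemma quotmod_scaleA a b x :
  quotmod_scale a (quotmod_scale b x) = quotmod_scale (a * b) x.
Proof. by have [y ->] := pi_quotmod_surj x; rewrite !pi_quotmodZ scalerA. Qed.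

Lemma quotmod_scale1 : left_id 1 quotmod_scale.
Proof. by move=> x; have [y ->] := pi_quotmod_surj x; rewrite pi_quotmodZ scale1r. Qed.

Lemma quotmod_scaleDr : right_distributive quotmod_scale +%R.
Proof.
move=> a x y; have [u ->] := pi_quotmod_surj x.
have [v ->] := pi_quotmod_surj y.
by rewrite -pi_quotmodD !pi_quotmodZ scalerDr pi_quotmodD.
Qed.

Lemma quotmod_scaleDl x : {morph quotmod_scale^~ x : a b / a + b}.
Proof.
move=> a b /=; have [y ->] := pi_quotmod_surj x.
by rewrite !pi_quotmodZ scalerDl pi_quotmodD.
Qed.

HB.instance Definition _ := GRing.Zmodule_isLmodule.Build R quotmod
  quotmod_scaleA quotmod_scale1 quotmod_scaleDr quotmod_scaleDl.
End QuotientModule.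

Definition isomorphic (R : pzRingType) (M N : lmodType R) :=
  exists f : {linear M -> N}, bijective f.

Section Annihilators.
Variables (R : pzRingType) (M : lmodType R).

Lemma annihilator_closed (X : set M) :
  submod_closed (in_set [set r : R^o | forall x, X x -> (r : R) *: x = 0]).
Proof.
split=> [|a u v]; first by apply/mem_set => x _; exact: scale0r.
move=> /set_mem uX /set_mem vX; apply/mem_set => x Xx.
by rewrite scalerDl -scalerA uX // vX // scaler0 addr0.
Qed.

Definition annihilator (X : set M) : ideal R :=
  Submodule (annihilator_closed X).

Definition annihilated (I : set R) : set M :=
  [set m | forall r, I r -> r *: m = 0].

Definition scale_image (a : R) : set M := [set a *: m | m in [set: M]].

Definition colon (N : set M) : set R := [set r | scale_image r `<=` N].
End Annihilators.

Arguments annihilated {R} M I.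
Arguments scale_image {R} M a.

Lemma principal_closed (R : pzRingType) (a : R) :
  submod_closed (in_set [set r * a | r in [set: R]] : {pred R^o}).
Proof.
split=> [|b u v]; first by apply/mem_set; exists 0; rewrite ?mul0r.
move=> /set_mem[r _ <-] /set_mem[s _ <-]; apply/mem_set.
by exists (b * r + s); rewrite // mulrDl -mulrA.
Qed.

Definition principal (R : pzRingType) (a : R) : ideal R :=
  Submodule (principal_closed a).

Section ModuleProperties.
Variables (R : pzRingType) (M : lmodType R).
Implicit Types N L : submodule M.

Definition proper_submodule N := (N : set M) <> [set: M].

Definition completely_irreducible N :=
  proper_submodule N /\
  forall (I : Type) (F : I -> submodule M),
    (N : set M) = \bigcap_i F i -> exists i, (N : set M) = F i.

Definition finitely_cogenerated :=
  forall (I : Type) (F : I -> submodule M),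
    \bigcap_i (F i : set M) = [set 0] ->
    exists2 D : set I, finite_set D & \bigcap_(i in D) (F i : set M) = [set 0].

Definition comorphic :=
  forall L, completely_irreducible L ->
    exists a : R, (L : set M) = scale_image M a /\
      colon L = [set x + y | x in (principal a : set R) &
                             y in (annihilator [set: M] : set R)].

Definition double_annihilator :=
  forall I : ideal R, (I : set R) = annihilator (annihilated M I).

Definition I0M : set M :=
  \bigcap_(L in [set L | completely_irreducible L /\
                         exists2 r : R, r != 0 & scale_image M r `<=` L])
     (L : set M).
End ModuleProperties.

Arguments I0M {R} M _.

Definition co_bezout (R : pzRingType) (M : lmodType R) :=
  forall N : submodule M,
    proper_submodule N -> finitely_cogenerated (quotmod N) -> completely_irreducible N.

Definition morphic_ring (R : comPzRingType) :=
  forall a : R,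
    isomorphic (quotmod (principal a)) (submod (annihilator (principal a))).

(* Main.v *)
(** Every submodule is an intersection of completely irreducible ones, and a
    completely irreducible submodule aM with a <> 0 contains [I0M M]; so
    [I0M M <> 0] forces 0 to be completely irreducible in M. By DAC, M is
    faithful, and for r <> 0 the module M / (0 :_M r) = rM is a nonzero
    submodule of M, so (0 :_M r) is completely irreducible, hence equal to some
    aM, with (aM :_R M) = Ra = Ann r; DAC then gives Ann a = Rr. This shows that
    R is morphic and that every cM has the form (0 :_M w), so that a proper cM
    is completely irreducible. Finally, if bM = (0 :_M s) and (0 :_M sa) = dM,
    then the intersection of aM and bM is a(0 :_M sa) = adM; hence a finite
    intersection of completely irreducible submodules is again some cM. *)
Require Import Defs.
From HB Require Import structures.
From mathcomp Require Import all_boot all_algebra.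
From mathcomp Require Import boolp classical_sets cardinality.

Local Open Scope classical_set_scope.
Local Open Scope ring_scope.

Set Implicit Arguments.
Unset Strict Implicit.

Import GRing.Theory.

(** * Completely irreducible submodules and quotient modules *)

Section Submodules.
Variables (R : pzRingType) (M : lmodType R).
Implicit Types (N L : submodule M).

Lemma submodule0 N : (N : set M) 0.
Proof. exact/set_mem/(submodule_closed N).1. Qed.

Lemma submoduleP N a x y :
  (N : set M) x -> (N : set M) y -> (N : set M) (a *: x + y).
Proof.
move=> Nx Ny; apply/set_mem/(submodule_closed N).2; exact/mem_set.
Qed.

Lemma mk_submodule (A : set M) :
  A 0 -> (forall a x y, A x -> A y -> A (a *: x + y)) ->
  exists N, (N : set M) = A.
Proof.
move=> A0 AP.
have Ac : submod_closed (in_set A).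
  split=> [|a x y /set_mem Ax /set_mem Ay]; apply/mem_set => //.
  exact: AP.
by exists (Submodule Ac).
Qed.

(** Zorn's lemma gives [L] maximal among the submodules that contain [N] and miss [x]. Every
    strictly larger submodule contains [x], so an intersection of such submodules contains [x] and
    cannot be [L]. *)
Lemma completely_irreducible_avoiding N x : ~ (N : set M) x ->
  exists L, [/\ completely_irreducible L, (N : set M) `<=` L & ~ (L : set M) x].
Proof.
move=> Nx.
(* [N `|` A] rather than [A], so that the empty chain has the bound [N]. *)
pose P (A : set M) := ~ (N `|` A) x /\
  forall a u v, (N `|` A) u -> (N `|` A) v -> (N `|` A) (a *: u + v).
have PU F : F `<=` P -> total_on F subset -> P (\bigcup_(X in F) X).
  move=> FP Ftot; split=> [[//|[X FX Xx]]|a u v].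
    by apply: (FP X FX).1; right.
  have inX X w : F X -> (N `|` X) w -> (N `|` \bigcup_(X in F) X) w.
    by move=> FX [?|?]; [left|right; exists X].
  case=> [Nu|[X FX Xu]] [Nv|[Y FY Yv]].
  - by left; exact: submoduleP.
  - by apply: (inX Y) => //; apply: (FP Y FY).2; [left|right].
  - by apply: (inX X) => //; apply: (FP X FX).2; [right|left].
  - case: (Ftot X Y FX FY) => [XY|YX].
      by apply: (inX Y) => //; apply: (FP Y FY).2; right => //; exact: XY.
    by apply: (inX X) => //; apply: (FP X FX).2; right => //; exact: YX.
have [A [[Ax AP] Amax]] := Zorn_bigcup PU.
have [L LE] : exists L, (L : set M) = N `|` A.
  by apply: mk_submodule => //; left; exact: submodule0.
have NL : (N : set M) `<=` L by rewrite LE; exact: subsetUl.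
have Lx : ~ (L : set M) x by rewrite LE.
exists L; split=> //; split=> [LT|I F LF]; first by apply: Lx; rewrite LT.
apply: contrapT => LnF; apply: (Lx); rewrite LF => i _.
apply: contrapT => Fix; apply: LnF; exists i.
have LFi : (L : set M) `<=` F i by rewrite LF; exact: bigcap_inf.
rewrite eqEsubset; split=> // y Fiy; apply: contrapT => Ly.
have NFi : N `|` F i = F i by apply/setUidr; exact: subset_trans NL LFi.
apply: (Amax (F i)); last first.
  by rewrite /P NFi; split=> // a u v; exact: submoduleP.
split=> [|FiA]; first by move=> z Az; apply: LFi; rewrite LE; right.
by apply: Ly; rewrite LE; right; exact: FiA.
Qed.

Lemma completely_irreducible_zero : comorphic M -> I0M M <> [set 0] ->
  exists2 L, completely_irreducible L & (L : set M) = [set 0].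
Proof.
move=> Mco I0; have [Z ZE] : exists Z : submodule M, (Z : set M) = [set 0].
  by apply: mk_submodule => // a x y -> ->; rewrite scaler0 addr0.
have [x Ix xN0] : exists2 x, I0M M x & x <> 0.
  apply: contrapT => noX; apply: I0; rewrite eqEsubset; split=> [x Ix|_ ->].
    by apply: contrapT => xN0; apply: noX; exists x.
  by move=> L _; exact: submodule0.
have Zx : ~ (Z : set M) x by rewrite ZE.
have [L [Lci _ Lx]] := completely_irreducible_avoiding Zx.
exists L => //; have [a [La _]] := Mco L Lci.
(* If [a] is nonzero, [L = aM] is one of the submodules that [I0M M] intersects, which would put [x]
   in [L]. *)
have [a0|aN0] := eqVneq a 0.
  rewrite La a0 eqEsubset; split=> [_ [m _ <-]|_ ->]; first exact: scale0r.
  by exists 0; rewrite ?scaler0.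
by case: Lx; apply: Ix; split=> //; exists a; rewrite // -La.
Qed.

(** First isomorphism theorem. *)
Lemma quotmod_isomorphic (M' : lmodType R) (f : {linear M -> M'}) N :
  (forall x, f x = 0 <-> (N : set M) x) -> (forall y, exists x, f x = y) ->
  isomorphic (quotmod N) M'.
Proof.
move=> kerf surjf.
pose g (x : quotmod N) : M' := f (repr x).
have gE x : g (\pi_(quotmod N)%qT x) = f x.
  apply/eqP; rewrite -subr_eq0 -linearB; apply/eqP/kerf/set_mem.
  by have := pi_quotmodE N (repr (\pi_(quotmod N)%qT x)) x; rewrite reprK eqxx.
have glin : linear g.
  move=> a x y; have [u ->] := pi_quotmod_surj x.
  have [v ->] := pi_quotmod_surj y.
  have -> : a *: \pi_(quotmod N)%qT u = \pi_(quotmod N)%qT (a *: u).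
    exact: pi_quotmodZ.
  by rewrite -pi_quotmodD !gE linearP.
pose G := GRing.isLinear.Build R (quotmod N) M' _ g glin.
pose g' : {linear quotmod N -> M'} := HB.pack g G.
exists g'.
have [h hK] := choice surjf.
exists (fun y => \pi_(quotmod N)%qT (h y)) => [x|y] /=; last by rewrite gE hK.
have [u ->] := pi_quotmod_surj x; rewrite gE.
apply/eqP; rewrite pi_quotmodE; apply/mem_set/kerf.
by rewrite linearB hK subrr.
Qed.

End Submodules.

Lemma quotmod_image (R : pzRingType) (M : lmodType R) (N L : submodule M) :
  exists G : submodule (quotmod N),
    (G : set (quotmod N)) = [set \pi_(quotmod N)%qT y | y in (L : set M)].
Proof.
apply: mk_submodule => [|a _ _ [u Lu <-] [v Lv <-]].
  by exists 0; [exact: submodule0|exact: pi_zeror].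
exists (a *: u + v); first exact: submoduleP.
by rewrite pi_quotmodD -pi_quotmodZ.
Qed.

Lemma quotmod_eq0 (R : pzRingType) (M : lmodType R) (N : submodule M) (x : M) :
  \pi_(quotmod N)%qT x = 0 <-> (N : set M) x.
Proof.
have <- : \pi_(quotmod N)%qT 0 = 0 by exact: pi_zeror.
split=> [/eqP|Nx]; first by rewrite pi_quotmodE subr0 => /set_mem.
by apply/eqP; rewrite pi_quotmodE subr0; exact: mem_set.
Qed.

(** * Annihilators of ring elements in the ring and in the module *)

Section Comorphic.
Variables (R : comPzRingType) (M : lmodType R).
Implicit Types (N L : submodule M) (a c r s t u : R).

(** In symbols: (0 :_M r) = aM, Ann r = Ra and Ann a = Rr. The two ring conditions are symmetric in
    [r] and [a]; the module condition becomes so by [annihilator_pair_sym]. *)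
Definition annihilator_pair r a :=
  [/\ forall m : M, r *: m = 0 <-> scale_image M a m,
      forall t, t * r = 0 <-> exists s, s * a = t &
      forall t, t * a = 0 <-> exists s, s * r = t].

(** This is DAC for the zero ideal. *)
Lemma annihilator_setTP (Mda : double_annihilator M) r :
  (forall m : M, r *: m = 0) -> r = 0.
Proof.
move=> rM; have : (annihilator (annihilated M (principal (0 : R))) : set R) r.
  by move=> m _; exact: rM.
by rewrite -Mda => -[s _ <-]; rewrite mulr0.
Qed.

Lemma double_annihilator_principal (Mda : double_annihilator M) r t :
  (forall m : M, r *: m = 0 -> t *: m = 0) -> exists s, s * r = t.
Proof.
move=> rt; have : (annihilator (annihilated M (principal r)) : set R) t.
  move=> m rm; apply/rt/(rm r); exists 1; rewrite ?mul1r //.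
by rewrite -Mda => -[s _ <-]; exists s.
Qed.

Lemma scale_submodule N r :
  exists L, (L : set M) = [set r *: m | m in (N : set M)].
Proof.
apply: mk_submodule => [|b _ _ [u Nu <-] [v Nv <-]].
  by exists 0; [exact: submodule0|exact: scaler0].
exists (b *: u + v); first exact: submoduleP.
by rewrite scalerDr !scalerA mulrC.
Qed.

(* Multiplication by [r] embeds [M / N] into [M], where [0] is completely
   irreducible. *)
Lemma completely_irreducible_annihilated Z N r :
  completely_irreducible Z -> (Z : set M) = [set 0] ->
  (N : set M) = [set m : M | r *: m = 0] -> (exists m : M, r *: m <> 0) ->
  completely_irreducible N.
Proof.
move=> [_ Zci] Z0 NE [m0 rm0].
have Nproper : proper_submodule N.
  by move=> NT; apply: rm0; have : [set: M] m0 by []; rewrite -NT NE.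
split=> // I F NF; apply: contrapT => nN.
have [G GE] := choice (fun i => scale_submodule (F i) r).
have [j] : exists i, (Z : set M) = G i.
  apply: Zci; rewrite Z0 eqEsubset; split=> [_ -> i _|y Gy].
    exact: submodule0.
  (* An empty intersection would be all of [M], but [N] is proper. *)
  have [i0 _] : exists i0 : I, True.
    apply: contrapT => nI; apply: Nproper; rewrite NF.
    by rewrite eqEsubset; split=> // m _ i; case: nI; exists i.
  have := Gy i0 Logic.I; rewrite GE => -[m _ ym].
  (* Two preimages of [y] under multiplication by [r] differ by an element of [N], and [N] lies in
     every [F i]; so the preimage [m] taken from [F i0] lies in all of them. *)
  have : (N : set M) m.
    rewrite NF => i _; have := Gy i Logic.I; rewrite GE => -[m' Fm' ym'].
    have Nm : (N : set M) (m - m') by rewrite NE /= scalerBr ym ym' subrr.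
    rewrite -[m](subrK m') -[m - m']scale1r; apply: submoduleP => //.
    by move: Nm; rewrite NF; apply.
  by rewrite NE /= ym.
rewrite Z0 GE => jE; apply: nN; exists j.
rewrite eqEsubset; split=> [|m Fm]; first by rewrite NF; exact: bigcap_inf.
by rewrite NE /=; suff : [set 0] (r *: m) by []; rewrite jE; exists m.
Qed.

Hypotheses (Mco : comorphic M) (Mda : double_annihilator M).
Hypothesis I0 : I0M M <> [set 0].

Lemma annihilated_completely_irreducible N r : r <> 0 ->
  (N : set M) = [set m | r *: m = 0] -> completely_irreducible N.
Proof.
move=> rN0 NE; have [Z Zci Z0] := completely_irreducible_zero Mco I0.
apply: (completely_irreducible_annihilated Zci Z0 NE) => //.
apply: contrapT => rM; apply: rN0; apply: annihilator_setTP => // m.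
by apply: contrapT => rm; apply: rM; exists m.
Qed.

Lemma annihilator_pair_exists r : exists a, annihilator_pair r a.
Proof.
(* The case [r = 0] is separate: (0 :_M 0) is [M], which is not proper, and the partner of 0 is
   1. *)
have [->|/eqP rN0] := eqVneq r 0.
  exists 1; split=> [m|t|t]; split.
  - by exists m; rewrite ?scale1r.
  - by rewrite scale0r.
  - by exists t; rewrite mulr1.
  - by rewrite mulr0.
  - by rewrite mulr1 => ->; exists 0; rewrite mulr0.
  - by move=> [s <-]; rewrite mulr0 mul0r.
have [N NE] : exists N, (N : set M) = [set m | r *: m = 0].
  apply: mk_submodule => [|a x y /= rx ry]; first exact: scaler0.
  by rewrite scalerDr scalerA mulrC -scalerA rx ry scaler0 addr0.
have [a [Na colonN]] := Mco (annihilated_completely_irreducible rN0 NE).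
have kerr m : r *: m = 0 <-> scale_image M a m.
  by rewrite -Na NE.
have annr t : t * r = 0 <-> exists s, s * a = t.
  (* If [t * r = 0], then [t] maps [M] into (0 :_M r) = [N], so [t] lies in Ra + Ann M, where Ann M
     = 0. *)
  split=> [tr0|[s <-]].
    have : colon N t.
      by move=> _ [m _ <-]; rewrite NE /= scalerA mulrC tr0 scale0r.
    rewrite colonN => -[_ [s _ <-]] [v vM <-]; exists s.
    by rewrite [v]annihilator_setTP ?addr0 // => m; exact: vM.
  apply: annihilator_setTP => // m.
  by rewrite mulrC (mulrC s) -!scalerA; apply/kerr; exists (s *: m).
(* If [t * a = 0], then [t] kills aM = (0 :_M r), and DAC for Rr puts [t] in Rr. *)
exists a; split=> // t; split=> [ta0|[s <-]].
  apply: double_annihilator_principal => // m /kerr[m' _ <-].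
  by rewrite scalerA ta0 scale0r.
by rewrite -mulrA (mulrC r) (iffRL (annr a)) ?mulr0 //; exists 1; rewrite mul1r.
Qed.

(** If [b] is a partner of [a], then Rb = Ann a = Rr, hence (0 :_M a) = bM = rM. *)
Lemma annihilator_pair_sym r a : annihilator_pair r a -> annihilator_pair a r.
Proof.
move=> [_ annr anna]; split=> // m.
have [b [kera annb _]] := annihilator_pair_exists a.
have [s sb] : exists s, s * r = b.
  by apply/anna/annb; exists 1; rewrite mul1r.
have [t tr] : exists t, t * b = r.
  by apply/annb/anna; exists 1; rewrite mul1r.
rewrite kera; split=> -[m' _ <-].
  by exists (s *: m'); rewrite // scalerA mulrC sb.
by exists (t *: m'); rewrite // scalerA mulrC tr.
Qed.

Lemma principal_completely_irreducible N c :
  proper_submodule N -> (N : set M) = scale_image M c ->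
  completely_irreducible N.
Proof.
move=> NT Nc.
have [w /annihilator_pair_sym[kerw _ _]] := annihilator_pair_exists c.
have NE : (N : set M) = [set m | w *: m = 0].
  by rewrite Nc; apply/seteqP; split=> m /= /kerw.
apply: (annihilated_completely_irreducible _ NE) => w0; apply: NT.
by rewrite NE w0; apply/seteqP; split=> // m _; exact: scale0r.
Qed.

Lemma scale_imageI a b :
  exists c, scale_image M a `&` scale_image M b = scale_image M c.
Proof.
have [s /annihilator_pair_sym[kers _ _]] := annihilator_pair_exists b.
have [d [kersa _ _]] := annihilator_pair_exists (s * a).
exists (a * d); apply/seteqP; split=> [_ [[m _ <-] /kers]|_ [m _ <-]].
  rewrite scalerA => /kersa[m' _ <-].
  by exists m'; rewrite // scalerA.
split; first by exists (d *: m); rewrite // scalerA.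
by apply/kers; rewrite scalerA mulrA -scalerA; apply/kersa; exists m.
Qed.

Lemma scale_image_bigcap (T : choiceType) (F : T -> submodule M) (l : seq T) :
  (forall i, exists a, (F i : set M) = scale_image M a) ->
  exists c, \bigcap_(i in [set` l]) (F i : set M) = scale_image M c.
Proof.
move=> FP; rewrite bigcap_seq; elim: l => [|i l [c IH]].
  exists 1; rewrite big_nil; apply/seteqP; split=> // m _.
  by exists m; rewrite ?scale1r.
have [a Fa] := FP i; have [d aId] := scale_imageI a c.
by exists d; rewrite big_cons Fa IH.
Qed.

(** For a partner [b] of [a], multiplication by [b] on [R] has kernel Ann b = Ra and image Rb = Ann
    a. *)
Lemma morphic : morphic_ring R.
Proof.
move=> a; have [b [_ annb anna]] := annihilator_pair_exists a.
have ba : b * a = 0 by apply/annb; exists 1; rewrite mul1r.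
have bP (x : R^o) : submodule_pred (annihilator (principal a)) (x * b : R^o).
  apply/mem_set => _ [s _ <-].
  by rewrite /GRing.scale /= mulrCA -(mulrA x) ba !mulr0.
pose f (x : R^o) : submod (annihilator (principal a)) := Sub _ (bP x).
have flin : linear f.
  by move=> t x y; apply: val_inj; rewrite /= mulrDl -mulrA.
pose F := GRing.isLinear.Build R R^o _ _ f flin.
pose f' : {linear R^o -> submod (annihilator (principal a))} := HB.pack f F.
apply: (quotmod_isomorphic (f := f')) => [x|[y yP]].
  split=> [/(congr1 val) /= /anna[s sx]|[s _ sx]]; first by exists s.
  by apply: val_inj; apply/anna; exists s.
have /annb[s sb] : y * a = 0.
  by apply: (set_mem yP); exists 1; rewrite ?mul1r.
by exists s; apply: val_inj.
Qed.

Lemma co_bezoutP : co_bezout M.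
Proof.
move=> N NT Nfc.
(* The family is indexed by all of [M]. For [x] in [N] the last condition is vacuous, and some
   completely irreducible [L] above [N] exists because [N] is proper. *)
have avoid x : exists L, [/\ completely_irreducible L, (N : set M) `<=` L &
    (L : set M) x -> (N : set M) x].
  have [Nx|Nx] := pselect ((N : set M) x); last first.
    by have [L [? ? ?]] := completely_irreducible_avoiding Nx; exists L.
  have [y Ny] : exists y, ~ (N : set M) y.
    apply: contrapT => nN; apply: NT; apply/seteqP; split=> // y _.
    by apply: contrapT => Ny; apply: nN; exists y.
  by have [L [? ? ?]] := completely_irreducible_avoiding Ny; exists L.
have [L LP] := choice avoid.
have [G GE] := choice (fun x => @quotmod_image _ _ N (L x)).
have GP x y : (G x : set _) (\pi_(quotmod N)%qT y) -> (L x : set M) y.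
  rewrite GE => -[z Lz /eqP]; rewrite eq_sym pi_quotmodE => /set_mem yz.
  have [_ NL _] := LP x.
  by rewrite -[y](subrK z) -[y - z]scale1r; apply: submoduleP => //; exact: NL.
(* The [L x] intersect in [N], so their images in M/N intersect in 0, and finitely many of these
   suffice. *)
have [D Dfin DE] : exists2 D : set M, finite_set D &
    \bigcap_(x in D) (G x : set (quotmod N)) = [set 0].
  apply: Nfc; apply/seteqP; split=> [y|_ -> x _]; last exact: submodule0.
  have [z -> Gz] := pi_quotmod_surj y; apply/quotmod_eq0.
  by have [_ _] := LP z; apply; exact/GP/Gz.
have [l Dl] := (finite_seqP _).1 Dfin.
have [|c lc] := @scale_image_bigcap _ L l.
  by move=> x; have [Lci _ _] := LP x; have [a [? _]] := Mco Lci; exists a.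
apply: (principal_completely_irreducible (c := c) NT); rewrite -lc -Dl.
apply/seteqP; split=> [y Ny x _|y Ly]; first by have [_ NL _] := LP x; exact: NL.
have : (\bigcap_(x in D) (G x : set (quotmod N))) (\pi_(quotmod N)%qT y).
  by move=> x Dx; rewrite GE; exists y => //; exact: Ly.
by rewrite DE => /quotmod_eq0.
Qed.

End Comorphic.

Theorem theorem2p15 (R : comPzRingType) (M : lmodType R) :
  comorphic M -> double_annihilator M -> I0M M <> [set 0] ->
  morphic_ring R /\ co_bezout M.
Proof.
move=> Mco Mda I0; split; first exact: morphic Mco Mda I0.
exact: co_bezoutP.
Qed.
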